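(* For every positive integer $n$, $$(6n+1)\binom{5n}{n}\ \Big|\ \binom{3n-1}{n-1}C_{3n}^{(4)}\qquad\text{and}\qquad \binom{3n}{n}\ \Big|\ \binom{5n-1}{n-1}C_{5n}^{(2)}.$$
   Context: For $h,m\in\mathbb{N}$, $C_m^{(h)}=\frac{1}{hm+1}\binom{(h+1)m}{m}$ is the generalized Catalan number of order $h$ (an integer); thus $C_{3n}^{(4)}=\binom{15n}{3n}/(12n+1)$ and $C_{5n}^{(2)}=\binom{15n}{5n}/(10n+1)$. *)

(* Defs.v *)
From mathcomp Require Import all_boot.

Set Implicit Arguments.
Unset Strict Implicit.
Unset Printing Implicit Defensive.

(* [%/] is Euclidean division on [nat]; it is exact here, see
   [gen_catalan_exact] below. *)
Definition gen_catalan (h m : nat) : nat :=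
  'C((h + 1) * m, m) %/ (h * m + 1).

Lemma gen_catalan_dvd (h m : nat) : h * m + 1 %| 'C((h + 1) * m, m).
Proof.
case: m => [|m]; first by rewrite !muln0 bin0.
have co : coprime (h * m.+1 + 1) m.+1.
  by rewrite /coprime gcdnC gcdnMDl gcdn1.
rewrite -(Gauss_dvdr _ co) mul_bin_left.
have -> : (h + 1) * m.+1 - m = h * m.+1 + 1.
  by rewrite mulnDl mul1n -addn1 addnCA addKn addn1.
exact: dvdn_mulr.
Qed.

Lemma gen_catalan_exact (h m : nat) :
  gen_catalan h m * (h * m + 1) = 'C((h + 1) * m, m).
Proof. exact: divnK (gen_catalan_dvd h m). Qed.

(* Main.v *)
Require Import Defs.
From mathcomp Require Import all_boot.
From mathcomp Require Import zify.

Set Implicit Arguments.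
Unset Strict Implicit.

(** Clearing denominators, the two claims read
    [3 (12n+1) (6n+1) (12n)! (5n)! (2n)! %| (15n)! (4n)!] and
    [5 (10n+1) (4n)! (10n)! (3n)! %| (15n)! (2n)!].
    By Legendre's formula each reduces to an inequality of floors for every
    prime power [q], and every floor involved is a function of
    [J = 60 n %/ q], because 15, 12, 10, 5, 4, 3, 2 divide 60.  In [J] the
    inequalities are periodic of period 60.  The extra factors 3 and 5 need
    one power [q] of that prime where the inequality is strict. *)

(** * Valuations as sums over prime powers *)

Lemma sum_nat_widen0 (F : nat -> nat) (m N : nat) :
    0 < m -> m <= N -> (forall k, m <= k -> F k = 0) ->
  \sum_(1 <= k < m) F k = \sum_(1 <= k < N) F k.
Proof.
move=> m_gt0 lemN F0; rewrite [RHS](@big_cat_nat _ _ _ m) //=.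
rewrite [X in _ = _ + X]big_nat_cond [X in _ = _ + X]big1 ?addn0 //.
by move=> k /andP[/andP[/F0]].
Qed.

(** One [F] serves all primes, and the common cut-off [N] replaces the bound that varies with each
    factor, so that products become pointwise sums. *)
Definition logn_layers (N a : nat) (F : nat -> nat) : Prop :=
  0 < a /\ forall p, prime p -> logn p a = \sum_(1 <= k < N) F (p ^ k).

Lemma logn_layers_fact (N m : nat) :
  m < N -> logn_layers N m`! (fun q => m %/ q).
Proof.
move=> ltmN; split=> [|p pr_p]; first exact: fact_gt0.
rewrite logn_fact //; apply: sum_nat_widen0 => // k ltmk.
by rewrite divn_small // (ltn_trans ltmk) // ltn_expl // prime_gt1.
Qed.

Lemma logn_layers_dvdn (N m : nat) :
  0 < m -> m <= N -> logn_layers N m (fun q => q %| m).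
Proof.
move=> m_gt0 lemN; split=> // p pr_p; rewrite logn_count_dvd //.
apply: sum_nat_widen0 => // k lemk.
by rewrite gtnNdvd // (leq_ltn_trans lemk) // ltn_expl // prime_gt1.
Qed.

Lemma logn_layersM (N a b : nat) (F G : nat -> nat) :
    logn_layers N a F -> logn_layers N b G ->
  logn_layers N (a * b) (fun q => F q + G q).
Proof.
move=> [a_gt0 logF] [b_gt0 logG]; split=> [|p pr_p].
  by rewrite muln_gt0 a_gt0.
by rewrite lognM // logF // logG // -big_split.
Qed.

(** Valuations are compared power by power; for [r] the term at [r ^ k] is split off, and its gap of
    at least 1 absorbs the extra factor [r]. *)
Lemma dvdn_logn_layers (N D E r k : nat) (F G : nat -> nat) :
    logn_layers N D F -> logn_layers N E G -> prime r ->
    (forall q, 1 < q -> F q <= G q) ->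
    0 < k < N -> F (r ^ k) < G (r ^ k) ->
  r * D %| E.
Proof.
move=> [D_gt0 logD] [E_gt0 logE] pr_r leFG /andP[k_gt0 ltkN] ltFG.
have r_gt0 := prime_gt0 pr_r.
have leFGX p i : prime p -> 0 < i -> F (p ^ i) <= G (p ^ i).
  by move=> pr_p i_gt0; rewrite leFG // -(exp1n i) ltn_exp2r ?prime_gt1.
apply/dvdn_partP=> [|p]; first by rewrite muln_gt0 r_gt0.
rewrite mem_primes p_part => /andP[pr_p _].
rewrite pfactor_dvdn // lognM // logn_prime // logD // logE //.
case: (eqVneq p r) => [->|_]; last first.
  rewrite add0n big_nat_cond [leqRHS]big_nat_cond leq_sum //.
  by move=> i /andP[/andP[i_gt0 _] _]; apply: leFGX.
have k_in : k \in index_iota 1 N by rewrite mem_index_iota k_gt0.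
rewrite (big_rem k k_in) [leqRHS](big_rem k k_in) /= addnA leq_add //.
rewrite big_seq [leqRHS]big_seq leq_sum // => i /mem_rem.
by rewrite mem_index_iota => /andP[i_gt0 _]; apply: leFGX.
Qed.

(** * Floors as functions of [J], and the weak inequalities *)

Lemma divn_of_60 (c d n q : nat) :
  0 < d -> c * d = 60 -> (c * n) %/ q = (60 * n) %/ q %/ d.
Proof. by move=> d_gt0 <-; rewrite -divnMA mulnAC divnMr. Qed.

(** The two bounds say that [s] is the ceiling of [c / q], and [c * a / q = c * u - c / q]. *)
Lemma divn_mul_pred (a c s q u : nat) :
  u * q = a + 1 -> s * q < c + q -> c <= s * q -> (c * a) %/ q = c * u - s.
Proof.
move=> def_a lt_s ge_s.
have q_gt0 : 0 < q by case: (q) def_a; lia.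
have s_le : s <= c by nia.
have u_gt0 : 0 < u by case: (u) def_a; lia.
have le_scu : s <= c * u by nia.
apply/eqP; rewrite eqn_leq -ltnS ltn_divLR // leq_divRL //.
have : (c * u - s) * q + s * q = c * a + c by rewrite -mulnDl subnK //; nia.
by rewrite mulSn; lia.
Qed.

Lemma coprime_of_mul_succ (q u c n : nat) :
  u * q = c * n + 1 -> coprime q c /\ coprime u c.
Proof.
move=> def_n; apply/andP; rewrite andbC -coprimeMl def_n coprime_sym.
by rewrite /coprime mulnC gcdnMDl gcdn1.
Qed.

Lemma coprime_residue (u c : nat) :
  0 < c -> coprime u c -> u %% c \in [seq i <- iota 0 c | coprime i c].
Proof.
by move=> c_gt0 co; rewrite mem_filter coprime_modl co mem_iota ltn_mod.
Qed.

(** If [q] divides neither number, this is periodic arithmetic in [J]. If [u * q = c * n + 1] with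
    [c] = 12 or 6, then [J] is [(60 / c) * u] minus a ceiling, and [u] coprime to [c] leaves few
    residues of [J] modulo 60. *)
Lemma floor_leq_12_5_2 (n q : nat) : 1 < q ->
  (q %| 12 * n + 1) + (q %| 6 * n + 1) + (12 * n) %/ q + (5 * n) %/ q
    + (2 * n) %/ q <= (15 * n) %/ q + (4 * n) %/ q.
Proof.
move=> q_gt1.
rewrite (@divn_of_60 12 5) // (@divn_of_60 5 12) // (@divn_of_60 2 30) //.
rewrite (@divn_of_60 15 4) // (@divn_of_60 4 15) //.
have [dv1|ndv1] := boolP (q %| 12 * n + 1).
  have -> : (q %| 6 * n + 1) = false.
    apply/negP=> dv2; suff: q %| 1 by rewrite dvdn1; lia.
    rewrite -(dvdn_addr _ dv1).
    by have -> : 12 * n + 1 + 1 = 2 * (6 * n + 1) by [lia]; rewrite dvdn_mull.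
  case/dvdnP: dv1 => u /esym def_n.
  have [/coprime_residue q12 /coprime_residue] := coprime_of_mul_succ def_n.
  have {q12} := q12 isT; rewrite /= !inE => q12 /(_ isT) u12.
  have -> : (60 * n) %/ q = 5 * u - 1.
    by rewrite -(@divn_mul_pred (12 * n) _ _ q) ?mulnA //; lia.
  lia.
have [/dvdnP[u /esym def_n]|ndv2] := boolP (q %| 6 * n + 1); last by lia.
have [/coprime_residue q6 /coprime_residue] := coprime_of_mul_succ def_n.
have {q6} := q6 isT; rewrite /= !inE => q6 /(_ isT) u6.
(* The ceiling of [10 / q] is 2 or 1 accordingly. *)
have {q6} : 5 <= q < 10 \/ 10 <= q by lia.
case=> q_bd.
  have -> : (60 * n) %/ q = 10 * u - 2.
    by rewrite -(@divn_mul_pred (6 * n) _ _ q) ?mulnA //; lia.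
  lia.
have -> : (60 * n) %/ q = 10 * u - 1.
  by rewrite -(@divn_mul_pred (6 * n) _ _ q) ?mulnA //; lia.
lia.
Qed.

Lemma floor_leq_10_4_3 (n q : nat) : 1 < q ->
  (q %| 10 * n + 1) + (4 * n) %/ q + (10 * n) %/ q + (3 * n) %/ q
    <= (15 * n) %/ q + (2 * n) %/ q.
Proof.
move=> q_gt1.
rewrite (@divn_of_60 4 15) // (@divn_of_60 10 6) // (@divn_of_60 3 20) //.
rewrite (@divn_of_60 15 4) // (@divn_of_60 2 30) //.
have [/dvdnP[u /esym def_n]|ndv] := boolP (q %| 10 * n + 1); last by lia.
have [/coprime_residue q10 /coprime_residue] := coprime_of_mul_succ def_n.
have {q10} := q10 isT; rewrite /= !inE => q10 /(_ isT) u10.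
(* The ceiling of [6 / q] is 2 for [q = 3] and 1 otherwise. *)
have {q10} : q = 3 \/ 6 <= q by lia.
case=> q_bd.
  have -> : (60 * n) %/ q = 6 * u - 2.
    by rewrite -(@divn_mul_pred (10 * n) _ _ q) ?mulnA //; lia.
  lia.
have -> : (60 * n) %/ q = 6 * u - 1.
  by rewrite -(@divn_mul_pred (10 * n) _ _ q) ?mulnA //; lia.
lia.
Qed.

(** * Strictness at some power of 3, respectively of 5 *)

Lemma floor_lt_12_5_2_pow3 (n : nat) : 0 < n -> exists2 k, 0 < k &
  (3 ^ k %| 12 * n + 1) + (3 ^ k %| 6 * n + 1) + (12 * n) %/ 3 ^ k
    + (5 * n) %/ 3 ^ k + (2 * n) %/ 3 ^ k < (15 * n) %/ 3 ^ k + (4 * n) %/ 3 ^ k.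
Proof.
move=> n_gt0.
have ndvd c k : 0 < k -> 3 %| c -> (3 ^ k %| c * n + 1) = false.
  move=> k_gt0 dv_c; apply/negP=> /(dvdn_trans (dvdn_exp k_gt0 (dvdnn 3))).
  by rewrite dvdn_addr // dvdn_mulr.
suff [k k_gt0 lt_k] : exists2 k, 0 < k & let J := (60 * n) %/ 3 ^ k in
    J %/ 5 + J %/ 12 + J %/ 30 < J %/ 4 + J %/ 15.
  exists k => //; rewrite !ndvd //= !add0n.
  rewrite (@divn_of_60 12 5) // (@divn_of_60 5 12) // (@divn_of_60 2 30) //.
  by rewrite (@divn_of_60 15 4) // (@divn_of_60 4 15).
have [m co_m ->] := @pfactor_coprime 3 n isT n_gt0; set a := logn 3 n.
have def_J j : (60 * (m * 3 ^ a)) %/ 3 ^ (a + j.+1) = (20 * m) %/ 3 ^ j.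
  rewrite addnS -addSn expnD expnS.
  have -> : 60 * (m * 3 ^ a) = (20 * m) * (3 * 3 ^ a) by lia.
  by rewrite divnMA mulnK // muln_gt0 expn_gt0.
have {co_m} m3 : m %% 3 != 0.
  by move: co_m; rewrite prime_coprime // /dvdn.
(* Failure at [j = 0] forces [m] to be 2 modulo 3, and failure at [j = 1] then forces 2 modulo 9. At
   [j = 2] this makes [J] equal to 4 modulo 20, where the inequality is strict. *)
have [|not0] := boolP ((20 * m) %/ 5 + (20 * m) %/ 12 + (20 * m) %/ 30
    < (20 * m) %/ 4 + (20 * m) %/ 15).
  by exists (a + 1); rewrite ?(def_J 0) ?divn1 // addn1.
have [|not1] := boolP (let J := (20 * m) %/ 3 in
    J %/ 5 + J %/ 12 + J %/ 30 < J %/ 4 + J %/ 15).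
  by exists (a + 2); rewrite ?(def_J 1) // addn2.
by exists (a + 3); rewrite ?(def_J 2) /=; lia.
Qed.

(* The class of [J] says that the fractional part of [n / q] is in [3/4, 4/5],
   where the inequality is an equality.  The fixed point 3/4 of
   [x |-> (3 + x) / 5] lets this persist for arbitrarily many powers of 5, so
   no bounded number of them suffices. *)
Lemma floor_lt_10_4_3_descent (J : nat) : 45 <= J %% 60 <= 48 ->
  exists j, let I := J %/ 5 ^ j in
    I %/ 15 + I %/ 6 + I %/ 20 < I %/ 4 + I %/ 30.
Proof.
have [b] := ubnP J; elim: b J => // b IHb J ltJb J_class.
have [|not1] := boolP (let I := J %/ 5 in
    I %/ 15 + I %/ 6 + I %/ 20 < I %/ 4 + I %/ 30); first by exists 1.
(* [J %/ 5] is 9 modulo 12, so without strictness it is 21 or 45 modulo 60. From 21 the next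
   quotient is 4 modulo 12, always strict; 45 is in the class again. *)
have [|not2] := boolP (let I := J %/ 25 in
    I %/ 15 + I %/ 6 + I %/ 20 < I %/ 4 + I %/ 30); first by exists 2.
have ltJ5 : J %/ 5 < b by lia.
have [|j lt_j] := IHb _ ltJ5; first by lia.
by exists j.+1; rewrite expnS divnMA.
Qed.

Lemma floor_lt_10_4_3_pow5 (n : nat) : 0 < n -> exists2 k, 0 < k &
  (5 ^ k %| 10 * n + 1) + (4 * n) %/ 5 ^ k + (10 * n) %/ 5 ^ k
    + (3 * n) %/ 5 ^ k < (15 * n) %/ 5 ^ k + (2 * n) %/ 5 ^ k.
Proof.
move=> n_gt0.
have ndvd k : 0 < k -> (5 ^ k %| 10 * n + 1) = false.
  move=> k_gt0; apply/negP=> /(dvdn_trans (dvdn_exp k_gt0 (dvdnn 5))).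
  by rewrite dvdn_addr // dvdn_mulr.
suff [k k_gt0 lt_k] : exists2 k, 0 < k & let J := (60 * n) %/ 5 ^ k in
    J %/ 15 + J %/ 6 + J %/ 20 < J %/ 4 + J %/ 30.
  exists k => //; rewrite ndvd //= add0n.
  rewrite (@divn_of_60 4 15) // (@divn_of_60 10 6) // (@divn_of_60 3 20) //.
  by rewrite (@divn_of_60 15 4) // (@divn_of_60 2 30).
have [m co_m ->] := @pfactor_coprime 5 n isT n_gt0; set a := logn 5 n.
have def_J j : (60 * (m * 5 ^ a)) %/ 5 ^ (a + j.+1) = (12 * m) %/ 5 ^ j.
  rewrite addnS -addSn expnD expnS.
  have -> : 60 * (m * 5 ^ a) = (12 * m) * (5 * 5 ^ a) by lia.
  by rewrite divnMA mulnK // muln_gt0 expn_gt0.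
suff [j lt_j] : exists j, let I := (12 * m) %/ 5 ^ j in
    I %/ 15 + I %/ 6 + I %/ 20 < I %/ 4 + I %/ 30.
  by exists (a + j.+1); rewrite ?def_J // addnS.
have {co_m} m5 : m %% 5 != 0.
  by move: co_m; rewrite prime_coprime // /dvdn.
(* Modulo 60, [12 * m] is 12, 24, 36 or 48: strict at 12 and 36, strict after one division by 5 at
   24, and in the descent class at 48. *)
have [/eqP m4|m_neq4] := boolP (m %% 5 == 4).
  by apply: floor_lt_10_4_3_descent; lia.
have [/eqP m2|m_neq2] := boolP (m %% 5 == 2); first by exists 1 => /=; lia.
by exists 0; rewrite divn1 /=; lia.
Qed.

(** * Divisibility between products of factorials *)

Lemma expn_lt_of_floor (p k a b c : nat) :
  1 < p -> c < (a %/ p ^ k) + (b %/ p ^ k) -> k <= a + b.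
Proof.
move=> p_gt1; apply: contraTT; rewrite -ltnNge => lt_k.
have lt_pk := ltn_trans lt_k (ltn_expl k p_gt1).
by rewrite !divn_small ?ltn0 //; lia.
Qed.

Lemma fact_dvd_12_5_2 (n : nat) : 0 < n ->
  3 * ((12 * n + 1) * (6 * n + 1) * (12 * n)`! * (5 * n)`! * (2 * n)`!)
    %| (15 * n)`! * (4 * n)`!.
Proof.
move=> n_gt0; have [k k_gt0 lt_k] := @floor_lt_12_5_2_pow3 n n_gt0.
pose N := (15 * n + 4 * n).+1.
(* Strictness makes a floor on the right nonzero, which keeps [k] below the cut-off. *)
have lt_kN : 0 < k < N.
  by rewrite k_gt0 ltnS; apply: (@expn_lt_of_floor 3 k) lt_k.
have le15n c : c <= 15 -> c * n <= 15 * n by rewrite leq_mul2r orbC => ->.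
have fct c : c <= 15 -> logn_layers N (c * n)`! (fun q => (c * n) %/ q).
  by move=> c_le; apply: logn_layers_fact; rewrite ltnS (leq_trans (le15n _ c_le)) ?leq_addr.
have dvd c : c <= 15 -> logn_layers N (c * n + 1) (fun q => q %| c * n + 1).
  move=> c_le; apply: logn_layers_dvdn; rewrite addn1 // ltnS.
  by rewrite (leq_trans (le15n _ c_le)) ?leq_addr.
have LD := logn_layersM (logn_layersM (logn_layersM (logn_layersM
  (dvd 12 isT) (dvd 6 isT)) (fct 12 isT)) (fct 5 isT)) (fct 2 isT).
have LE := logn_layersM (fct 15 isT) (fct 4 isT).
exact: (dvdn_logn_layers LD LE _ (floor_leq_12_5_2 n) lt_kN lt_k).
Qed.

Lemma fact_dvd_10_4_3 (n : nat) : 0 < n ->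
  5 * ((10 * n + 1) * (4 * n)`! * (10 * n)`! * (3 * n)`!)
    %| (15 * n)`! * (2 * n)`!.
Proof.
move=> n_gt0; have [k k_gt0 lt_k] := @floor_lt_10_4_3_pow5 n n_gt0.
pose N := (15 * n + 2 * n).+1.
have lt_kN : 0 < k < N.
  by rewrite k_gt0 ltnS; apply: (@expn_lt_of_floor 5 k) lt_k.
have le15n c : c <= 15 -> c * n <= 15 * n by rewrite leq_mul2r orbC => ->.
have fct c : c <= 15 -> logn_layers N (c * n)`! (fun q => (c * n) %/ q).
  by move=> c_le; apply: logn_layers_fact; rewrite ltnS (leq_trans (le15n _ c_le)) ?leq_addr.
have dvd : logn_layers N (10 * n + 1) (fun q => q %| 10 * n + 1).
  apply: logn_layers_dvdn; rewrite addn1 // ltnS.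
  by rewrite (leq_trans (le15n 10 isT)) ?leq_addr.
have LD := logn_layersM (logn_layersM (logn_layersM
  dvd (fct 4 isT)) (fct 10 isT)) (fct 3 isT).
have LE := logn_layersM (fct 15 isT) (fct 2 isT).
exact: (dvdn_logn_layers LD LE _ (floor_leq_10_4_3 n) lt_kN lt_k).
Qed.

(** * Return to binomial coefficients *)

Lemma mul_bin_fact (c n : nat) :
  'C(c.+1 * n, n) * (n`! * (c * n)`!) = (c.+1 * n)`!.
Proof. by rewrite -[c * n](addKn n) -mulSn bin_fact // leq_pmull. Qed.

(** The factor [c.+1] is the source of the extra 3 and 5. *)
Lemma mul_bin_pred_fact (c n : nat) : 0 < n ->
  c.+1 * 'C(c.+1 * n - 1, n - 1) * (n`! * (c * n)`!) = (c.+1 * n)`!.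
Proof.
move=> n_gt0; rewrite -mul_bin_fact; congr (_ * _); apply/eqP.
rewrite -(eqn_pmul2l n_gt0) mulnA [n * _]mulnC !subn1 mul_bin_diag.
by rewrite prednK.
Qed.

Lemma gen_catalan_fact (h m : nat) :
  gen_catalan h m * (h * m + 1) * (m`! * (h * m)`!) = ((h + 1) * m)`!.
Proof. by rewrite gen_catalan_exact addn1 mul_bin_fact. Qed.

Theorem theorem1p3 (n : nat) (n_gt0 : 0 < n) :
  ((6 * n + 1) * 'C(5 * n, n) %| 'C(3 * n - 1, n - 1) * gen_catalan 4 (3 * n))
  /\ ('C(3 * n, n) %| 'C(5 * n - 1, n - 1) * gen_catalan 2 (5 * n)).
Proof.
have catalan4 : gen_catalan 4 (3 * n) * (12 * n + 1) * ((3 * n)`! * (12 * n)`!)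
    = (15 * n)`! by have := gen_catalan_fact 4 (3 * n); rewrite !(mulnA _ _ n).
have catalan2 : gen_catalan 2 (5 * n) * (10 * n + 1) * ((5 * n)`! * (10 * n)`!)
    = (15 * n)`! by have := gen_catalan_fact 2 (5 * n); rewrite !(mulnA _ _ n).
have bin5 := mul_bin_fact 4 n; have bin3 := mul_bin_fact 2 n.
have pbin5 := @mul_bin_pred_fact 4 n n_gt0.
have pbin3 := @mul_bin_pred_fact 2 n n_gt0.
split.
  (* [K] clears every denominator and leaves [(3 * n)!] as common factor of both sides. *)
  pose K := 3 * (12 * n + 1) * n`! * (2 * n)`! * (3 * n)`! * (12 * n)`! * (4 * n)`!.
  have K_gt0 : 0 < K by rewrite !muln_gt0 !fact_gt0 !addn1.
  rewrite -(dvdn_pmul2l K_gt0).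
  have -> : K * ('C(3 * n - 1, n - 1) * gen_catalan 4 (3 * n))
      = (3 * n)`! * ((15 * n)`! * (4 * n)`!).
    by rewrite -pbin3 -catalan4 /K; lia.
  have -> : K * ((6 * n + 1) * 'C(5 * n, n)) = (3 * n)`! * (3 *
      ((12 * n + 1) * (6 * n + 1) * (12 * n)`! * (5 * n)`! * (2 * n)`!)).
    by rewrite -bin5 /K; lia.
  by rewrite dvdn_mul // fact_dvd_12_5_2.
(* Here the common factor left is [(5 * n)!]. *)
pose K := 5 * (10 * n + 1) * n`! * (2 * n)`! * (5 * n)`! * (10 * n)`! * (4 * n)`!.
have K_gt0 : 0 < K by rewrite !muln_gt0 !fact_gt0 !addn1.
rewrite -(dvdn_pmul2l K_gt0).
have -> : K * ('C(5 * n - 1, n - 1) * gen_catalan 2 (5 * n))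
    = (5 * n)`! * ((15 * n)`! * (2 * n)`!).
  by rewrite -pbin5 -catalan2 /K; lia.
have -> : K * 'C(3 * n, n) = (5 * n)`! * (5 *
    ((10 * n + 1) * (4 * n)`! * (10 * n)`! * (3 * n)`!)).
  by rewrite -bin3 /K; lia.
by rewrite dvdn_mul // fact_dvd_10_4_3.
Qed.
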